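(* Let $d\ge3$ and let $G$ be a bipartite graph with bipartition $(U,W)$ such that $$\sum_{v\in N(u)}\frac{1}{d-\deg(v)}\le 1\qquad\text{for all } u\in U.$$ Then $t(G,d)$ is finite.
   Context: Graphs are finite and simple; $N(u)$ is the neighborhood and $\deg(v)$ the degree. $G=(V,E)$ is $d$-sparse if it has no subgraph isomorphic to $K_{a,b}$ with $a,b\ge1$, $a+b>d$ (the hypothesis implies $G$ is $d$-sparse). $S^{d-1}$ is the unit sphere of $\mathbb{R}^d$, $A_k$ the surface area of $S^k\subset\mathbb{R}^{k+1}$, and $\mathrm{Det}(y_1,\dots,y_m)=\sqrt{\det((y_i^{\top}y_j)_{i,j})}$ ($=1$ for the empty family). For an ordering (bijection) $p:V\to\{1,\dots,|V|\}$ let $N_p(v)=\{w:vw\in E,\ p(w)<p(v)\}$, $d_p(v)=|N_p(v)|$, $x_p(v)=(x_w:w\in N_p(v))$. Let $\rho_p$ be the distribution on $(S^{d-1})^V$ of the random sequential ortho-homomorphism: process nodes in increasing $p$, choosing $x_v$ uniformly from the sphere $\{y\in S^{d-1}: y\perp x_w\ \forall w\in N_p(v)\}$. The ortho-homomorphism density is $$t(G,d)=\int \frac{A_{d-1}^{|E|-|V|}}{A_{d-2}^{|E|}}\prod_{v\in V}\frac{A_{d-d_p(v)-1}}{\mathrm{Det}(x_p(v))}\,d\rho_p(x)\in(0,\infty],$$ which does not depend on $p$. (For bipartite $G$ with classes $U,W$ this equals $\frac{A_{d-1}^{|E|-|W|}}{A_{d-2}^{|E|}}\int_{(S^{d-1})^U}\prod_{v\in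 W}\frac{A_{d-\deg(v)-1}}{\mathrm{Det}(x(N(v)))}\,d\pi^U(x)$, $\pi$ the uniform probability measure on $S^{d-1}$.) *)

(* Defs.v *)
From HB Require Import structures.
From mathcomp Require Import all_boot all_order all_algebra.
From mathcomp Require Import all_classical all_reals.
From mathcomp Require Import ereal topology normedtype sequences trigo exp
  measure lebesgue_measure lebesgue_integral.
Set Implicit Arguments. Unset Strict Implicit. Unset Printing Implicit Defensive.
Import Order.TTheory GRing.Theory Num.Theory.
Local Open Scope ring_scope.

Section OrthoHom.
Variable R : realType.

(* A_k = surface area of the unit sphere S^k in R^(k+1):
   A_0 = 2, A_1 = 2 pi, A_(k+2) = 2 pi / (k+1) * A_k. *)
Fixpoint sphere_area (k : nat) : R :=
  match k with
  | 0%N => 2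
  | 1%N => pi *+ 2
  | k'.+2 => (pi *+ 2) / (k'.+1)%:R * sphere_area k'
  end.

Definition dotv (d : nat) (a b : 'rV[R]_d) : R := \sum_(i < d) a 0 i * b 0 i.
Definition enorm (d : nat) (a : 'rV[R]_d) : R := Num.sqrt (dotv a a).
Definition normalize (d : nat) (a : 'rV[R]_d) : 'rV[R]_d := (enorm a)^-1 *: a.

Definition Detv (d : nat) (s : seq 'rV[R]_d) : R :=
  Num.sqrt (\det (\matrix_(i < size s, j < size s) dotv (nth 0 s i) (nth 0 s j))).

Definition gauss1 (t : R) : R := (Num.sqrt (pi *+ 2))^-1 * expR (- (t ^+ 2) / 2).

(* Iterated integral of a nonnegative function of the coordinates indexed by
   the list s (other coordinates frozen at x0) against the product of
   standard Gaussians in these coordinates (Tonelli: this is the integral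
   against the product Gaussian measure on R^s). *)
Fixpoint gauss_int (K : eqType) (s : seq K) (f : (K -> R) -> \bar R)
    (x0 : K -> R) : \bar R :=
  match s with
  | [::] => f x0
  | k :: s' =>
      (\int[@lebesgue_measure R]_(t in setT)
         ((gauss1 t)%:E * gauss_int s' f (fun j => if j == k then t else x0 j)))%E
  end.

(* Integral of F : (T -> R^d) -> \bar R (depending only on the U-coordinates)
   against pi^U, the product over U of the uniform probability measure on
   S^(d-1).  pi is realised as the law of g/|g|, g a standard Gaussian
   vector of R^d. *)
Definition sphere_int (T : finType) (d : nat) (U : {set T})
    (F : (T -> 'rV[R]_d) -> \bar R) : \bar R :=
  gauss_int [seq (u, i) | u <- enum U, i <- enum 'I_d]
    (fun y => F (fun u => normalize (\row_(i < d) y (u, i))))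
    (fun _ => 0).

Definition nbhd (T : finType) (e : rel T) (v : T) : {set T} := [set w | e v w].
Definition deg (T : finType) (e : rel T) (v : T) : nat := #|nbhd e v|.
Definition nedges (T : finType) (e : rel T) : nat :=
  (#|[set p : T * T | e p.1 p.2]|)./2.

(* The bipartite formula for the ortho-homomorphism density t(G,d),
   G bipartite with classes U, W:
   A_{d-1}^{|E|-|W|} / A_{d-2}^{|E|} *
   int_{(S^{d-1})^U} prod_{v in W} A_{d-deg v-1} / Det(x(N(v))) dpi^U(x),
   where a factor with Det = 0 is +oo. *)
Definition ortho_integrand (T : finType) (e : rel T) (W : {set T}) (d : nat)
    (x : T -> 'rV[R]_d) : \bar R :=
  if [exists v in W, Detv [seq x w | w <- enum (nbhd e v)] == 0]
  then +oo%E
  else (\prod_(v in W)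
          (sphere_area (d - deg e v - 1) / Detv [seq x w | w <- enum (nbhd e v)]))%:E.

Definition ortho_density (T : finType) (e : rel T) (U W : {set T}) (d : nat)
    : \bar R :=
  ((sphere_area (d - 1) ^ ((nedges e)%:Z - (#|W|)%:Z)
     / sphere_area (d - 2) ^+ nedges e)%:E
   * sphere_int U (@ortho_integrand T e W d))%E.

End OrthoHom.

Definition bipartite_graph (T : finType) (e : rel T) (U W : {set T}) : Prop :=
  [/\ symmetric e, irreflexive e,
      U :|: W = [set: T], [disjoint U & W] &
      (forall x y, e x y -> (x \in U) = (y \in W))].

(* Main.v *)
(* Write p_v = d - deg v for v in W. By Finner's inequality for the product
   Gaussian measure,
     E prod_v Det(x(N(v)))^-1 <= prod_v E[Det(x(N(v)))^-p_v]^(1/p_v):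
   a coordinate of x_u occurs only in the factors v in N(u), whose weights
   1/p_v sum to at most 1. It remains to see that E[Det(x_1..x_k)^-(d-k)] is
   finite for k independent unit vectors. Normalizing Gaussian vectors y_i
   costs only a factor of polynomial growth, and by Cauchy-Binet Det(y_1..y_k)
   is bounded below by a multiple of the largest k x k minor; the latter is
   integrated out one vector at a time. *)
Require Import Defs.
From HB Require Import structures.
From mathcomp Require Import all_boot all_order all_algebra.
From mathcomp Require Import perm.
From mathcomp Require Import all_classical all_reals.
From mathcomp Require Import ereal topology normedtype sequences trigo exp
  measure lebesgue_measure lebesgue_integral.
From mathcomp Require Import measurable_realfun numfun normal_distribution.
From mathcomp Require Import ring lra zify.
Set Implicit Arguments. Unset Strict Implicit. Unset Printing Implicit Defensive.
Import Order.TTheory GRing.Theory Num.Theory.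
Import numFieldNormedType.Exports.
Local Open Scope ring_scope.

(** * Iterated Gaussian integrals *)

(** The exponent [d - k] fits for the following reason. Suppose [k - 1] rows are fixed and their
    largest minor [M] is nonzero. Then each of the [d - k + 1] columns outside that minor gives a
    lower bound for the largest minor of [k] rows: [M] times the distance of the new entry in that
    column from a point determined by the other columns. A power [-p] spread evenly over these
    columns leaves [p / (d - k + 1)] on each, which is below 1, hence integrable on the line,
    exactly for integers [p <= d - k]. Minors are used since they are affine in a single entry with
    explicit coefficients, so iterated one-dimensional integrals suffice and no rotation invariance
    enters. Singular values are kept as [+oo] throughout, so no null set is ever discarded. Since
    the Finner weights may sum to less than 1, the functions are made at least 1 beforehand and the
    leftover weight goes to the constant 1. *)

Lemma le_integral_nneg (d : measure_display) (T : measurableType d)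
    (R : realType) (mu : {measure set T -> \bar R}) (f g : T -> \bar R) :
  (forall x, 0 <= f x)%E -> (forall x, f x <= g x)%E ->
  (\int[mu]_x f x <= \int[mu]_x g x)%E.
Proof.
move=> f0 fg.
have g0 x : (0 <= g x)%E by exact: le_trans (f0 x) (fg x).
(* Both integrals are suprema over simple functions below the integrand, so the argument also covers
   the ortho-integrand, whose measurability is never established. *)
rewrite !ge0_integralTE//; apply: le_ereal_sup => _ [h /= hf <-].
by exists h => //= x; exact: le_trans (hf x) (fg x).
Qed.

Section GaussInt.
Variables (R : realType) (K : eqType).
Implicit Types (s : seq K) (x y : K -> R) (f g : (K -> R) -> \bar R).

(* Measurability of [F] as a function of its coordinates, phrased without
   putting a sigma-algebra on [K -> R]. *)
Definition coord_measurable (d : measure_display) (Y : measurableType d)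
    (F : (K -> R) -> Y) : Prop :=
  forall (d' : measure_display) (X : measurableType d') (phi : X -> K -> R),
    (forall k, measurable_fun [set: X] (fun z => phi z k)) ->
    measurable_fun [set: X] (fun z => F (phi z)).

Definition upd x k t : K -> R := fun j => if j == k then t else x j.

Lemma gauss1_ge0 (t : R) : 0 <= gauss1 t.
Proof. by rewrite mulr_ge0 ?expR_ge0// invr_ge0 sqrtr_ge0. Qed.

Lemma measurable_gauss1 : measurable_fun [set: R] (@gauss1 R).
Proof.
apply: measurable_funM => //; apply: measurableT_comp => //=.
by apply: measurable_funM => //=; apply: measurableT_comp.
Qed.

Lemma gauss1_normal (t : R) : gauss1 t = normal_pdf 0 1 t.
Proof.
rewrite normal_pdfE ?oner_eq0// /gauss1 /normal_peak /normal_fun.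
by rewrite subr0 expr1n mul1r.
Qed.

Lemma integral_gauss1 : (\int[@lebesgue_measure R]_t (gauss1 t)%:E = 1)%E.
Proof.
by under eq_integral do rewrite gauss1_normal; exact: integral_normal_pdf.
Qed.

Lemma gauss_int_ge0 s f x : (forall y, 0 <= f y)%E -> (0 <= gauss_int s f x)%E.
Proof.
move=> f0; elim: s x => [|k s IH] x //=.
by apply: integral_ge0 => t _; rewrite mule_ge0// lee_fin gauss1_ge0.
Qed.

Lemma gauss_int_le s f g x : (forall y, 0 <= f y)%E ->
  (forall y, (forall k, k \notin s -> y k = x k) -> f y <= g y)%E ->
  (gauss_int s f x <= gauss_int s g x)%E.
Proof.
move=> f0; elim: s x => [|k s IH] x fg /=; first exact: fg.
apply: le_integral_nneg => t.
  by rewrite mule_ge0 ?lee_fin ?gauss1_ge0// gauss_int_ge0.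
apply: lee_wpmul2l; first by rewrite lee_fin gauss1_ge0.
apply: IH => y yE; apply: fg => j; rewrite inE negb_or => /andP[jk js].
by rewrite yE// (negbTE jk).
Qed.

Lemma gauss_int_cat s1 s2 f x :
  gauss_int (s1 ++ s2) f x = gauss_int s1 (gauss_int s2 f) x.
Proof.
elim: s1 x => [|k s1 IH] x //=.
by under eq_integral do rewrite IH.
Qed.

Lemma coord_measurable_upd (d' : measure_display) (X : measurableType d')
    (phi : X -> K -> R) k :
  (forall j, measurable_fun [set: X] (fun z => phi z j)) ->
  forall j, measurable_fun [set: X * R] (fun z => upd (phi z.1) k z.2 j).
Proof.
move=> mphi j; rewrite /upd; case: (j == k); first exact: measurable_snd.
exact: (measurableT_comp (mphi j) measurable_fst).
Qed.

Lemma measurable_gaussM (d' : measure_display) (X : measurableType d')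
    (h : X * R -> \bar R) : measurable_fun [set: X * R] h ->
  measurable_fun [set: X * R] (fun z => (gauss1 z.2)%:E * h z)%E.
Proof.
move=> mh; apply: emeasurable_funM => //; apply/measurable_EFinP.
exact: (measurableT_comp measurable_gauss1 measurable_snd).
Qed.

(** The integrated coordinate is adjoined to the parameter space, and Tonelli gives measurability in
    the parameter. The induction needs [coord_measurable] to range over all spaces [X], since it
    passes from [X] to [X * R]. *)
Lemma coord_measurable_gauss_int s f : (forall y, 0 <= f y)%E ->
  coord_measurable f -> coord_measurable (gauss_int s f).
Proof.
move=> f0 mf; elim: s => [|k s IH] //= d' X phi mphi.
pose h := fun z : X * R =>
  ((gauss1 z.2)%:E * gauss_int s f (upd (phi z.1) k z.2))%E.
apply: (measurable_fun_fubini_tonelli_F (m2 := @lebesgue_measure R) h).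
  by apply: measurable_gaussM; apply: IH; exact: coord_measurable_upd.
by move=> z; rewrite mule_ge0 ?lee_fin ?gauss1_ge0// gauss_int_ge0.
Qed.

Lemma measurable_upd (d : measure_display) (Y : measurableType d)
    (F : (K -> R) -> Y) x k : coord_measurable F ->
  measurable_fun [set: R] (fun t => F (upd x k t)).
Proof.
move=> mF; apply: mF => j; rewrite /upd.
by case: (j == k) => //; exact: measurable_id.
Qed.

Lemma measurable_gauss1M (h : R -> \bar R) : measurable_fun [set: R] h ->
  measurable_fun [set: R] (fun t => (gauss1 t)%:E * h t)%E.
Proof.
move=> mh; apply: emeasurable_funM => //.
by apply/measurable_EFinP; exact: measurable_gauss1.
Qed.

Lemma measurable_gauss_upd F x k : coord_measurable F ->
  measurable_fun [set: R] (fun t => (gauss1 t)%:E * F (upd x k t) : \bar R)%E.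
Proof.
by move=> mF; apply: measurable_gauss1M; exact: measurable_upd.
Qed.

Lemma gauss_intZl s f x c : (forall y, 0 <= f y)%E -> coord_measurable f ->
  (0 <= c)%E -> gauss_int s (fun y => c * f y)%E x = (c * gauss_int s f x)%E.
Proof.
move=> f0 mf c0; elim: s x => [|k s IH] x //=.
under eq_integral do rewrite IH muleCA.
rewrite ge0_integralZl//.
- by apply: measurable_gauss_upd; exact: coord_measurable_gauss_int.
- by move=> t _; rewrite mule_ge0 ?lee_fin ?gauss1_ge0// gauss_int_ge0.
Qed.

Lemma gauss_intD s f g x : (forall y, 0 <= f y)%E -> coord_measurable f ->
  (forall y, 0 <= g y)%E -> coord_measurable g ->
  gauss_int s (fun y => f y + g y)%E x = (gauss_int s f x + gauss_int s g x)%E.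
Proof.
move=> f0 mf g0 mg; elim: s x => [|k s IH] x //=.
under eq_integral do rewrite IH ge0_muleDr ?gauss_int_ge0//.
rewrite ge0_integralD//.
- by move=> t _; rewrite mule_ge0 ?lee_fin ?gauss1_ge0// gauss_int_ge0.
- by apply: measurable_gauss_upd; exact: coord_measurable_gauss_int.
- by move=> t _; rewrite mule_ge0 ?lee_fin ?gauss1_ge0// gauss_int_ge0.
- by apply: measurable_gauss_upd; exact: coord_measurable_gauss_int.
Qed.

Lemma integral_gaussZ (c : \bar R) : (0 <= c)%E ->
  (\int[@lebesgue_measure R]_t ((gauss1 t)%:E * c) = c)%E.
Proof.
move=> c0; under eq_integral do rewrite muleC.
rewrite ge0_integralZl// ?integral_gauss1 ?mule1//.
  by apply/measurable_EFinP; exact: measurable_gauss1.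
by move=> t _; rewrite lee_fin gauss1_ge0.
Qed.

Lemma gauss_int_cst s c x : (0 <= c)%E ->
  gauss_int s (fun=> c) x = c.
Proof.
move=> c0; elim: s x => [|k s IH] x //=.
by under eq_integral do rewrite IH; exact: integral_gaussZ.
Qed.

Lemma gauss_int_cons k s f x : gauss_int (k :: s) f x =
  (\int[@lebesgue_measure R]_t ((gauss1 t)%:E * gauss_int s f (upd x k t)))%E.
Proof. by []. Qed.

Lemma gauss_int_swap k1 k2 s f x : (forall y, 0 <= f y)%E ->
  coord_measurable f ->
  gauss_int [:: k1, k2 & s] f x = gauss_int [:: k2, k1 & s] f x.
Proof.
move=> f0 mf; have [->//|k12] := eqVneq k1 k2.
set G := gauss_int s f.
have G0 y : (0 <= G y)%E by exact: gauss_int_ge0.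
have mG : coord_measurable G by exact: coord_measurable_gauss_int.
pose h := fun z : R * R =>
  ((gauss1 z.1)%:E * ((gauss1 z.2)%:E * G (upd (upd x k1 z.1) k2 z.2)))%E.
have mh : measurable_fun [set: R * R] h.
  apply: emeasurable_funM.
    apply/measurable_EFinP.
    exact: (measurableT_comp measurable_gauss1 measurable_fst).
  apply: measurable_gaussM; apply: mG => j.
  apply: (coord_measurable_upd (phi := upd x k1)) => i.
  by rewrite /upd; case: (i == k1) => //; exact: measurable_id.
have h0 z : (0 <= h z)%E.
  by rewrite /h !mule_ge0// lee_fin gauss1_ge0.
have Zl (z : K -> R) k (c : R) : 0 <= c ->
    (c%:E * \int[@lebesgue_measure R]_t ((gauss1 t)%:E * G (upd z k t)) =
     \int[@lebesgue_measure R]_t (c%:E * ((gauss1 t)%:E * G (upd z k t))))%E.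
  move=> c0; apply/esym; apply: ge0_integralZl_EFin => //.
  - by move=> t _; rewrite mule_ge0// lee_fin gauss1_ge0.
  - exact: measurable_gauss_upd.
have E k j : gauss_int [:: k, j & s] f x =
    (\int[@lebesgue_measure R]_t1 \int[@lebesgue_measure R]_t2
      ((gauss1 t1)%:E * ((gauss1 t2)%:E * G (upd (upd x k t1) j t2))))%E.
  rewrite gauss_int_cons; apply: eq_integral => t _.
  by rewrite gauss_int_cons -/G Zl// gauss1_ge0.
rewrite !E; apply: etrans (fubini_tonelli (m1 := @lebesgue_measure R)
  (m2 := @lebesgue_measure R) h mh h0) _.
apply: eq_integral => t2 _; apply: eq_integral => t1 _.
rewrite /h muleCA; congr (_ * (_ * G _))%E.
apply/funext => j; rewrite /upd; case: (eqVneq j k2) => // ->.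
by rewrite eq_sym (negbTE k12).
Qed.

(** Adjacent exchanges generate all orders. This allows a chosen row, and chosen columns in it, to
    be moved to the innermost integrals. *)
Lemma gauss_int_perm s1 s2 f x : (forall y, 0 <= f y)%E ->
  coord_measurable f -> perm_eq s1 s2 ->
  gauss_int s1 f x = gauss_int s2 f x.
Proof.
move=> f0 mf.
have toHead p1 p2 k z :
    gauss_int (p1 ++ k :: p2) f z = gauss_int (k :: p1 ++ p2) f z.
  elim: p1 z => [|j p1 IH] z //.
  rewrite [RHS]gauss_int_swap// !cat_cons gauss_int_cons [RHS]gauss_int_cons.
  by apply: eq_integral => t _; rewrite IH.
elim: s1 s2 x => [|k s1 IH] s2 x; first by rewrite perm_sym => /perm_nilP ->.
move=> p12; have /splitPr s2E : k \in s2 by rewrite -(perm_mem p12) mem_head.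
move: p12; case: s2E => p1 p2.
rewrite perm_sym perm_catC /= perm_cons perm_catC perm_sym => p12.
rewrite toHead !gauss_int_cons.
by apply: eq_integral => t _; rewrite (IH _ _ p12).
Qed.

End GaussInt.

(** * Finner's inequality *)

Section Finner.
Variables (R : realType) (I : finType).
Implicit Types (P : pred I) (a c : I -> R).

Lemma weighted_AM_GM P a (y : I -> R) :
  (forall i, P i -> 0 < y i) -> (forall i, P i -> 0 <= a i) ->
  \sum_(i | P i) a i <= 1 ->
  \prod_(i | P i) y i `^ a i <=
  \sum_(i | P i) a i * y i + (1 - \sum_(i | P i) a i).
Proof.
move=> y0 a0 a1; set A := \sum_(i | P i) a i in a1 *.
pose L := \sum_(i | P i) a i * ln (y i).
have -> : \prod_(i | P i) y i `^ a i = expR L.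
  by rewrite expR_sum; apply: eq_bigr => i Pi; rewrite /powR gt_eqF// y0.
(* Apply this bound to [t = ln (y i)] with weight [a i] and to [t = 0] with
   weight [1 - A]: the weighted sum of the left sides is exactly [expR L]. *)
have le1 (t : R) : expR L * (1 + (t - L)) <= expR t.
  rewrite -[in leRHS](subrK L t) [in leRHS]addrC expRD.
  by rewrite ler_pM2l ?expR_gt0// expR_ge1Dx.
have -> : expR L = \sum_(i | P i) a i * (expR L * (1 + (ln (y i) - L)))
    + (1 - A) * (expR L * (1 + (0 - L))).
  rewrite (eq_bigr (fun i => expR L * (1 - L) * a i
      + expR L * (a i * ln (y i)))); last by move=> i _; ring.
  by rewrite big_split/= -!mulr_sumr -/A -/L; ring.
apply: lerD.
  apply: ler_sum => i Pi; rewrite ler_wpM2l ?a0//.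
  by rewrite (le_trans (le1 _))// lnK ?posrE ?y0.
by rewrite -[leRHS]mulr1 ler_wpM2l ?subr_ge0// -[leRHS]expR0.
Qed.

(** This is [weighted_AM_GM] for the quotients [h i / c i]; the [c i] will be the integrals of the
    [h i], so that each term then integrates to [a i]. The bound [1 <= h i] excludes products of 0
    and [+oo]: a single infinite [h i] makes the right side infinite. *)
Lemma weighted_AM_GM_ereal P a c (h : I -> \bar R) :
  (forall i, P i -> 1 <= h i)%E -> (forall i, P i -> 0 < c i) ->
  (forall i, P i -> 0 < a i) -> \sum_(i | P i) a i <= 1 ->
  (\prod_(i | P i) h i `^ a i <= (\prod_(i | P i) c i `^ a i)%:E *
    (\sum_(i | P i) (a i / c i)%:E * h i + (1 - \sum_(i | P i) a i)%:E))%E.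
Proof.
move=> h1 c0 a0 a1.
have C0 : 0 < \prod_(i | P i) c i `^ a i.
  by apply: prodr_gt0 => i Pi; rewrite powR_gt0 ?c0.
have [/forall_inP hfin|] := boolP [forall (i | P i), h i \is a fin_num].
  have hE i : P i -> h i = (fine (h i))%:E by move=> /hfin ?; rewrite fineK.
  have f1 i : P i -> 1 <= fine (h i).
    by move=> Pi; rewrite -lee_fin -hE ?h1.
  have f0 i : P i -> 0 < fine (h i) by move=> /f1; exact: lt_le_trans.
  rewrite (eq_bigr (fun i => (fine (h i) `^ a i)%:E)); last first.
    by move=> i Pi; rewrite [in LHS]hE// poweR_EFin.
  rewrite prodEFin (eq_bigr (fun i => (a i / c i * fine (h i))%:E)); last first.
    by move=> i Pi; rewrite [in LHS]hE// EFinM.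
  rewrite sumEFin -EFinD -EFinM lee_fin -ler_pdivrMl//.
  apply: (@le_trans _ _ (\prod_(i | P i) (fine (h i) / c i) `^ a i)).
    rewrite -prodfV -big_split/= ler_prod// => i Pi.
    rewrite mulr_ge0 ?invr_ge0 ?powR_ge0//=.
    have c0' := ltW (c0 i Pi); rewrite powRM ?invr_ge0 ?(ltW (f0 i Pi))// mulrC.
    by rewrite -(powR_inv1 c0') powRAC powR_inv1 ?powR_ge0.
  apply: le_trans (weighted_AM_GM _ _ a1) _.
  - by move=> i Pi; rewrite divr_gt0 ?c0 ?f0.
  - by move=> i Pi; rewrite ltW// a0.
  - by rewrite lerD2r; apply: ler_sum => i Pi; rewrite mulrA mulrAC.
move=> /forall_inPn[i Pi hi].
have hy : h i = +oo%E.
  apply/eqP; move: hi; rewrite fin_numE negb_and !negbK => /orP[/eqP hN|//].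
  by have := h1 i Pi; rewrite hN.
apply: (le_trans (leey _)).
rewrite [X in (_ * (X + _))%E](bigD1 i)//= hy gt0_muley ?lte_fin ?divr_gt0 ?a0 ?c0//.
have s0 : (0 <= \sum_(j | P j && (j != i)) (a j / c j)%:E * h j)%E.
  apply: sume_ge0 => j /andP[Pj _]; rewrite mule_ge0 ?lee_fin//.
    by rewrite divr_ge0 ?ltW ?a0 ?c0.
  by rewrite (le_trans _ (h1 j Pj))// lee_fin.
rewrite -addeA addye ?gt0_muley ?lte_fin//.
by rewrite gt_eqF// (lt_le_trans (ltNyr 0))// adde_ge0// lee_fin subr_ge0.
Qed.

(** Integrate the arithmetic-geometric mean bound normalized by the integrals [J i]. The terms
    contribute the [a i], and the leftover weight contributes itself because the Gaussian has total
    mass 1; the sum is 1. *)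
Lemma gauss_Hoelder P a (h : I -> R -> \bar R) :
  (forall i, measurable_fun [set: R] (h i)) ->
  (forall i t, 1 <= h i t)%E ->
  (forall i, P i -> 0 < a i) -> \sum_(i | P i) a i <= 1 ->
  (\int[@lebesgue_measure R]_t ((gauss1 t)%:E * \prod_(i | P i) h i t `^ a i)
   <= \prod_(i | P i)
        (\int[@lebesgue_measure R]_t ((gauss1 t)%:E * h i t)) `^ a i)%E.
Proof.
move=> mh h1 a0 a1.
pose J i := (\int[@lebesgue_measure R]_t ((gauss1 t)%:E * h i t))%E.
rewrite -[leRHS]/(\prod_(i | P i) J i `^ a i)%E.
have g0 t : (0 <= (gauss1 t)%:E :> \bar R)%E by rewrite lee_fin gauss1_ge0.
have h0 i t : (0 <= h i t)%E by rewrite (le_trans _ (h1 i t))// lee_fin.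
have J1 i : (1 <= J i)%E.
  rewrite -(integral_gaussZ (c := 1%E)) ?lee_fin//.
  apply: le_integral_nneg => t; first by rewrite mule1.
  by apply: lee_wpmul2l; [exact: g0|exact: h1].
have mg : measurable_fun [set: R] (fun t : R => (gauss1 t)%:E).
  by apply/measurable_EFinP; exact: measurable_gauss1.
have [/forall_inP Jfin|] := boolP [forall (i | P i), J i \is a fin_num]; last first.
  move=> /forall_inPn[i Pi Ji].
  have Jy : J i = +oo%E.
    apply/eqP; move: Ji; rewrite fin_numE negb_and !negbK => /orP[/eqP hN|//].
    by have := J1 i; rewrite hN.
  rewrite [leRHS](bigD1 i)//= Jy poweRyr ?gt_eqF ?a0// gt0_mulye ?leey//.
  elim/big_ind : _ => //.
  - by move=> x y x0 y0; rewrite mule_gt0.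
  - by move=> j _; rewrite poweR_gt0// (lt_le_trans _ (J1 j))// lte_fin.
pose c i := fine (J i).
have JE i : P i -> J i = (c i)%:E by move=> /Jfin ?; rewrite fineK.
have c0 i : P i -> 0 < c i.
  by move=> Pi; rewrite -lte_fin -JE// (lt_le_trans _ (J1 i))// lte_fin.
set C := (\prod_(i | P i) c i `^ a i)%:E.
have -> : (\prod_(i | P i) J i `^ a i)%E = C.
  by rewrite /C -prodEFin; apply: eq_bigr => i Pi; rewrite JE// poweR_EFin.
have C0 : (0 <= C)%E by rewrite lee_fin prodr_ge0// => i _; rewrite powR_ge0.
pose b := (1 - \sum_(i | P i) a i)%:E.
have b0 : (0 <= b)%E by rewrite lee_fin subr_ge0.
pose w i := if P i then a i / c i else 0.
have w0 i : 0 <= w i.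
  by rewrite /w; case: ifPn => // Pi; rewrite divr_ge0// ltW// ?a0 ?c0.
pose S t := (\sum_(i <- index_enum I) (w i)%:E * ((gauss1 t)%:E * h i t))%E.
have S0 t : (0 <= S t)%E.
  by rewrite /S sume_ge0// => i _; rewrite !mule_ge0// lee_fin.
have mgh i : measurable_fun [set: R] (fun t => (gauss1 t)%:E * h i t)%E.
  exact: emeasurable_funM mg (mh i).
have mterm i : measurable_fun [set: R]
    (fun t => (w i)%:E * ((gauss1 t)%:E * h i t))%E.
  by apply: measurable_funeM; exact: mgh.
have mS : measurable_fun [set: R] S by exact: emeasurable_sum.
have mb : measurable_fun [set: R] (fun t : R => (gauss1 t)%:E * b)%E.
  exact: emeasurable_funM.
apply: (@le_trans _ _
  (\int[@lebesgue_measure R]_t (C * (S t + (gauss1 t)%:E * b)))%E).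
  apply: le_integral_nneg => t.
    by rewrite mule_ge0// prode_ge0// => i Pi; exact: poweR_ge0.
  apply: le_trans (lee_wpmul2l (g0 t)
    (weighted_AM_GM_ereal (fun i _ => h1 i t) c0 a0 a1)) _.
  have t0 i : P i -> (0 <= (a i / c i)%:E * h i t)%E.
    by move=> Pi; rewrite mule_ge0 ?h0// lee_fin divr_ge0// ltW// ?a0 ?c0.
  rewrite muleCA lee_wpmul2l// ge0_muleDr//; last by rewrite sume_ge0.
  rewrite leeD2r// ge0_sume_distrr// /S [leLHS]big_mkcond/=.
  rewrite le_eqVlt; apply/orP; left; apply/eqP; apply: eq_bigr => i _.
  by rewrite /w; case: ifP => Pi; rewrite ?mul0e// muleCA.
rewrite ge0_integralZl//; last 2 first.
- exact: emeasurable_funD.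
- by move=> t _; rewrite adde_ge0// mule_ge0.
rewrite -[leRHS]mule1 lee_wpmul2l// ge0_integralD//; last first.
  by move=> t _; rewrite mule_ge0.
rewrite integral_gaussZ// /S ge0_integral_sum//; last first.
  by move=> i t _; rewrite !mule_ge0// lee_fin.
rewrite (eq_bigr (fun i => if P i then (a i)%:E else 0%E)) => [|i _]; last first.
  rewrite ge0_integralZl ?lee_fin//; last 2 first.
  - exact: mgh.
  - by move=> t _; rewrite mule_ge0.
  rewrite -/(J i) /w; case: ifP => Pi; last by rewrite mul0e.
  by rewrite JE// -EFinM divfK// gt_eqF// c0.
by rewrite -big_mkcond sumEFin -EFinD addrC subrK.
Qed.

(* Finner's inequality: the weights of the functions that depend on a given
   coordinate need only sum to at most 1 coordinate by coordinate. *)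
Lemma gauss_Finner (K : eqType) (s : seq K) P a (dep : I -> pred K)
    (g : I -> (K -> R) -> \bar R) x :
  (forall i, coord_measurable (g i)) ->
  (forall i y, 1 <= g i y)%E ->
  (forall i k y t, P i -> ~~ dep i k -> g i (upd y k t) = g i y) ->
  (forall i, P i -> 0 < a i) ->
  (forall k, k \in s -> \sum_(i | P i && dep i k) a i <= 1) ->
  (gauss_int s (fun y => \prod_(i | P i) g i y `^ a i) x <=
   \prod_(i | P i) (gauss_int s (g i) x) `^ a i)%E.
Proof.
move=> mg g1 gdep a0; elim: s x => [|k s IH] x a1 //.
rewrite gauss_int_cons.
have g0 i y : (0 <= g i y)%E by rewrite (le_trans _ (g1 i y))// lee_fin.
have G1 i y : (1 <= gauss_int s (g i) y)%E.
  rewrite -[leLHS](@gauss_int_cst R K s 1 y) ?lee_fin//.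
  by apply: gauss_int_le => // z; rewrite ?lee_fin.
have G0 i y : (0 <= gauss_int s (g i) y)%E by exact: gauss_int_ge0.
have mG i : coord_measurable (gauss_int s (g i)).
  exact: coord_measurable_gauss_int.
have Gdep i y t : P i -> ~~ dep i k ->
    gauss_int s (g i) (upd y k t) = gauss_int s (g i) y.
  move=> Pi dik; elim: (s) y => [|j s' IHs] y; first exact: gdep.
  rewrite !gauss_int_cons; apply: eq_integral => u _; congr (_ * _)%E.
  (* The list may contain [k] again; the inner variable then overwrites the value [t]. *)
  have [->|jk] := eqVneq j k.
    by congr gauss_int; apply/funext => l; rewrite /upd; case: eqP.
  rewrite -[RHS]IHs; congr gauss_int; apply/funext => l; rewrite /upd.
  by case: (eqVneq l j) => // ->; rewrite (negbTE jk).
apply: (@le_trans _ _ (\int[@lebesgue_measure R]_t ((gauss1 t)%:E *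
    \prod_(i | P i) (gauss_int s (g i) (upd x k t)) `^ a i))%E).
  apply: le_integral_nneg => t.
    rewrite mule_ge0 ?lee_fin ?gauss1_ge0// gauss_int_ge0// => y.
    by apply: prode_ge0 => i _; exact: poweR_ge0.
  apply: lee_wpmul2l; first by rewrite lee_fin gauss1_ge0.
  by apply: IH => j js; rewrite a1// inE js orbT.
(* Factors independent of coordinate [k] leave the integral; Hoelder is applied to the others only,
   and their weights are the ones bounded by 1. *)
pose c := (\prod_(i | P i && ~~ dep i k) (gauss_int s (g i) x) `^ a i)%E.
have c0 : (0 <= c)%E by apply: prode_ge0 => i _; exact: poweR_ge0.
have split_dep (F : I -> \bar R) : (\prod_(i | P i) F i =
    (\prod_(i | P i && ~~ dep i k) F i) * \prod_(i | P i && dep i k) F i)%E.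
  by rewrite (bigID (fun i => dep i k))/= muleC.
have mprod : measurable_fun [set: R] (fun t => (gauss1 t)%:E *
    \prod_(i | P i && dep i k) (gauss_int s (g i) (upd x k t)) `^ a i)%E.
  apply: emeasurable_funM.
    by apply/measurable_EFinP; exact: measurable_gauss1.
  under eq_fun do rewrite -big_filter; elim: [seq i <- _ | _] => [|i r IHr].
    by under eq_fun do rewrite big_nil; exact: measurable_cst.
  under eq_fun do rewrite big_cons; apply: emeasurable_funM => //.
  by apply: (measurableT_comp (measurable_poweR _)); exact: measurable_upd.
have cE t : ((gauss1 t)%:E *
    \prod_(i | P i) (gauss_int s (g i) (upd x k t)) `^ a i = c * ((gauss1 t)%:E *
    \prod_(i | P i && dep i k) (gauss_int s (g i) (upd x k t)) `^ a i))%E.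
  rewrite split_dep muleCA; congr (_ * _)%E.
  by apply: eq_bigr => i /andP[Pi dik]; rewrite Gdep.
under eq_integral do rewrite cE.
rewrite ge0_integralZl//; last first.
  move=> t _; rewrite mule_ge0 ?lee_fin ?gauss1_ge0//.
  by apply: prode_ge0 => i _; exact: poweR_ge0.
rewrite split_dep; apply: lee_pmul => //.
- apply: integral_ge0 => t _; rewrite mule_ge0 ?lee_fin ?gauss1_ge0//.
  by apply: prode_ge0 => i _; exact: poweR_ge0.
- rewrite le_eqVlt; apply/orP; left; apply/eqP.
  apply: eq_bigr => i /andP[Pi dik]; congr poweR.
  rewrite gauss_int_cons; under eq_integral do rewrite Gdep//.
  by rewrite integral_gaussZ.
- apply: gauss_Hoelder => //.
  + by move=> i; exact: measurable_upd.
  + by move=> i /andP[/a0].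
  + by rewrite a1// mem_head.
Qed.
End Finner.

(** * A singular weight on the line *)

Section SingularWeight.
Variable R : realType.
Implicit Types (theta b t x : R) (p n : nat).

(* [|x|^(-theta)], with the value [+oo] at 0 that real inversion lacks. *)
Definition singpow theta x : \bar R :=
  if x == 0 then +oo%E else (`|x| `^ (- theta))%:E.

Lemma singpow_gt0 theta x : (0 < singpow theta x)%E.
Proof.
by rewrite /singpow; case: eqVneq => // x0; rewrite lte_fin powR_gt0// normr_gt0.
Qed.

Lemma measurable_singpow theta : measurable_fun [set: R] (singpow theta).
Proof.
apply: measurable_fun_ifT => //.
- by apply: measurable_fun_eqr => //; exact: measurable_id.
- apply/measurable_EFinP; apply: (measurableT_comp (measurable_powR _)).
  exact: normr_measurable.
Qed.

Definition dyadic n x : R := ((`|x| <= 2^-1 ^+ n)%R : bool)%:R.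

Lemma dyadic_ge0 n x : 0 <= dyadic n x.
Proof. by rewrite /dyadic ler0n. Qed.

(** If [2^-(n+1) < |x| <= 2^-n], the [n]-th term alone dominates. The summand 1 covers [|x| > 1],
    and at 0 every term is at least 1, so the series diverges as it must. Integrating the
    singularity thus reduces to lengths of intervals. *)
Lemma singpow_le_dyadic theta x : 0 <= theta ->
  (singpow theta x <= 1 +
    \sum_(0 <= n <oo) ((((2 : R) `^ theta) ^+ n.+1)%:E * (dyadic n x)%:E))%E.
Proof.
move=> th0; set r := (2 : R) `^ theta.
pose u := fun n => ((r ^+ n.+1)%:E * (dyadic n x)%:E)%E.
rewrite -/(u _).
have r1 : 1 <= r by rewrite -(@powRr0 R 2) ler_powR// ler1n.
have u0 n : (0 <= u n)%E.
  by rewrite mule_ge0// lee_fin ?dyadic_ge0// exprn_ge0// powR_ge0.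
have S0 : (0 <= \sum_(0 <= n <oo) u n)%E by apply: nneseries_ge0.
rewrite /singpow; case: eqVneq => [x0|xn0].
  suff -> : (\sum_(0 <= n <oo) u n = +oo)%E by rewrite addey.
  apply: eq_infty => A.
  apply: le_trans (nneseries_lim_ge (Num.truncn A).+1 _) => //.
  apply: (@le_trans _ _ (\sum_(0 <= n < (Num.truncn A).+1) 1)%E).
    by rewrite sumEFin lee_fin big_mkord sumr_const card_ord ltW// truncnS_gt.
  apply: lee_sum => n _; rewrite /u /dyadic x0 normr0 exprn_ge0 ?invr_ge0//.
  by rewrite mule1 lee_fin exprn_ege1.
have x0 : 0 < `|x| by rewrite normr_gt0.
have xE : `|x| `^ (- theta) = (`|x|^-1) `^ theta.
  by rewrite -(powR_inv1 (ltW x0)) -powRrM mulN1r.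
have [x1|x1] := leP `|x| 1; last first.
  rewrite -[leLHS]adde0 leeD// lee_fin xE.
  rewrite [leRHS](_ : 1 = 1 `^ theta); last by rewrite powR1.
  by rewrite ge0_ler_powR ?nnegrE ?invr_ge0 ?(ltW x0)// ltW// invf_lt1.
have exN : exists N, 2^-1 ^+ N < `|x|.
  exists (Num.truncn `|x|^-1).+1.
  rewrite exprVn invf_plt ?posrE ?exprn_gt0//.
  apply: lt_trans (truncnS_gt _) _.
  by rewrite -natrX ltr_nat ltn_expl.
case: (ex_minnP exN) => -[|n]; first by rewrite expr0 ltNge x1.
move=> xn minn; have xn' : `|x| <= 2^-1 ^+ n.
  by rewrite leNgt; apply/negP => /minn; rewrite ltnn.
apply: (@le_trans _ _ (u n)).
  rewrite /u /dyadic xn' mule1 lee_fin xE /r.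
  rewrite -powR_mulrn ?powR_ge0// powRAC powR_mulrn//.
  rewrite ge0_ler_powR ?nnegrE ?invr_ge0 ?exprn_ge0//.
  by rewrite -[leRHS]invrK lef_pV2 ?posrE ?invr_gt0 ?exprn_gt0// -exprVn ltW.
apply: (@le_trans _ _ (\sum_(0 <= n <oo) u n)%E); last first.
  by rewrite -[leLHS]add0e leeD2r.
apply: le_trans (nneseries_lim_ge n.+1 _) => //.
by rewrite big_nat_recr//= -[leLHS]add0e leeD2r// sume_ge0.
Qed.

(** Polynomial growth is absorbed by doubling the standard deviation: [(1 + |t|)^p <= exp (p |t|)]
    and [p |t| - t^2/2 <= p^2 - t^2/8]. The remaining factors exchange the normalizing constants. *)
Lemma gauss_weight_le p t : (1 + `|t|) ^+ p * gauss1 t <=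
  (expR (p%:R ^+ 2) * (Num.sqrt (pi *+ 2))^-1 / normal_peak 2)
    * normal_pdf 0 2 t.
Proof.
have pk : 0 < normal_peak (2 : R) by rewrite normal_peak_gt0.
rewrite normal_pdfE// /normal_fun subr0 -mulrA (mulrA _^-1) mulVf ?gt_eqF// mul1r.
rewrite /gauss1 mulrA [leLHS]mulrAC [leRHS]mulrAC ler_wpM2r ?invr_ge0 ?sqrtr_ge0//.
have : (1 + `|t|) ^+ p <= expR (p%:R * `|t|).
  by rewrite expRM_natl lerXn2r ?nnegrE ?addr_ge0 ?expR_ge0// expR_ge1Dx.
move=> /ler_wpM2r-/(_ _ (expR_ge0 (- t ^+ 2 / 2))) /le_trans; apply.
rewrite -!expRD ler_expR.
have -> : t ^+ 2 = `|t| ^+ 2 by rewrite real_normK ?num_real.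
set q : R := p%:R; set v := `|t|.
(* One sixth of this sum plus [v^2/24 + q^2/6] equals [3 v^2/8 - q v + q^2], the required slack. *)
have : 0 <= (v - q) ^+ 2 + (v - q *+ 2) ^+ 2 by rewrite addr_ge0 ?sqr_ge0.
nra.
Qed.

(** With [B] a pointwise bound of the weighted density, the [n]-th dyadic interval, of length
    [2 * 2^-n], contributes at most [2 B r (r/2)^n]; the series converges since [r = 2^theta < 2].
    Only lengths enter, so the bound is uniform in the centre [b], which will depend on other matrix
    entries. *)
Lemma gauss_singpow_bounded p theta : 0 <= theta < 1 ->
  exists2 C : R, 0 <= C & forall b,
  (\int[@lebesgue_measure R]_t ((gauss1 t)%:E *
    (((1 + `|t|) ^+ p)%:E * singpow theta (t - b))) <= C%:E)%E.
Proof.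
move=> /andP[th0 th1]; set r := (2 : R) `^ theta.
set K := expR (p%:R ^+ 2) * (Num.sqrt (pi *+ 2))^-1 / normal_peak (2 : R).
have pk : 0 < normal_peak (2 : R) by rewrite normal_peak_gt0.
have K0 : 0 <= K.
  by rewrite !mulr_ge0 ?invr_ge0 ?expR_ge0 ?sqrtr_ge0// ltW.
have r0 : 0 < r by rewrite powR_gt0.
have r2 : r / 2 < 1.
  rewrite ltr_pdivrMr// mul1r /r -[ltRHS](@powRr1 R 2)//.
  by rewrite /powR pnatr_eq0 ltr_expR ltr_pM2r ?ln_gt0 ?ltr1n.
pose B := K * normal_peak (2 : R).
have B0 : 0 <= B by rewrite mulr_ge0// ltW.
pose C := K + B * r * 2 / (1 - r / 2).
have r20 : 0 < 1 - r / 2 by rewrite subr_gt0.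
have r0' := ltW r0.
have Br0 : 0 <= B * r * 2 by apply: mulr_ge0 => //; apply: mulr_ge0.
exists C; first by apply: addr_ge0 => //; apply: divr_ge0 => //; exact: ltW.
move=> b.
pose v n t := ((B * r ^+ n.+1)%:E * (\1_(`[b - 2^-1 ^+ n, b + 2^-1 ^+ n]) t)%:E)%E.
have Brn n : 0 <= B * r ^+ n by apply: mulr_ge0 => //; apply: exprn_ge0.
have v0 n t : (0 <= v n t)%E.
  apply: mule_ge0; rewrite lee_fin; first exact: Brn.
  by rewrite indicE.
have mv n : measurable_fun [set: R] (v n).
  by apply: measurable_funeM; apply/measurable_EFinP; exact: measurable_indic.
have dE n t : dyadic n (t - b) = \1_(`[b - 2^-1 ^+ n, b + 2^-1 ^+ n]) t :> R.
  rewrite /dyadic indicE; congr (_%:R); rewrite ler_distl.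
  by rewrite mem_setE in_itv.
have mpdf : measurable_fun [set: R] (fun t => (K * normal_pdf 0 2 t)%:E).
  apply/measurable_EFinP; apply: measurable_funM => //.
  exact: measurable_normal_pdf.
have S0 t : (0 <= \sum_(0 <= n <oo) v n t)%E by apply: nneseries_ge0.
apply: (@le_trans _ _ (\int[@lebesgue_measure R]_t
    ((K * normal_pdf 0 2 t)%:E + \sum_(0 <= n <oo) v n t))%E).
  apply: le_integral_nneg => t.
    apply: mule_ge0; first by rewrite lee_fin gauss1_ge0.
    apply: mule_ge0; last exact/ltW/singpow_gt0.
    by rewrite lee_fin exprn_ge0// addr_ge0.
  rewrite muleA -EFinM (mulrC (gauss1 t)).
  have w0 : (0 <= ((1 + `|t|) ^+ p * gauss1 t)%:E)%E.
    by rewrite lee_fin mulr_ge0 ?gauss1_ge0// exprn_ge0// addr_ge0.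
  apply: le_trans (lee_wpmul2l w0 (singpow_le_dyadic (t - b) th0)) _.
  have D0 n : (0 <= (r ^+ n.+1)%:E * (dyadic n (t - b))%:E)%E.
    by rewrite mule_ge0 ?lee_fin ?dyadic_ge0// exprn_ge0.
  rewrite ge0_muleDr//; last by apply: nneseries_ge0.
  rewrite mule1 leeD//; first by rewrite lee_fin gauss_weight_le.
  rewrite -nneseriesZl//; apply: lee_nneseries => n _ //.
    by rewrite mule_ge0.
  rewrite muleA -EFinM dE /v -EFinM lee_fin; apply: ler_wpM2r.
    by rewrite indicE.
  apply: ler_wpM2r; first exact: exprn_ge0.
  by rewrite (le_trans (gauss_weight_le _ _))// ler_wpM2l// normal_pdf_ub.
rewrite ge0_integralD//; last 2 first.
- by move=> t _; rewrite lee_fin mulr_ge0// normal_pdf_ge0.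
- exact: (ge0_emeasurable_sum (P := xpredT)
    (fun n t _ _ => v0 n t) (fun n _ => mv n)).
rewrite /C EFinD leeD//.
  under eq_integral do rewrite EFinM.
  rewrite ge0_integralZl_EFin//.
  - by rewrite integral_normal_pdf mule1.
  - by move=> t _; rewrite lee_fin normal_pdf_ge0.
  - by apply/measurable_EFinP; exact: measurable_normal_pdf.
rewrite integral_nneseries//.
have IE n : (\int[@lebesgue_measure R]_t v n t =
    (geometric (B * r * 2) (r / 2) n)%:E)%E.
  rewrite ge0_integralZl_EFin//.
  - rewrite integral_indic//= setIT lebesgue_measure_itv/= lte_fin.
    rewrite ltrD2l (lt_trans (y := 0)) ?oppr_lt0 ?exprn_gt0//.
    rewrite -EFinD -EFinM; congr EFin.
    by rewrite /geometric/= exprS expr_div_n exprVn; field; rewrite expf_neq0.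
  - by apply/measurable_EFinP; exact: measurable_indic.
rewrite (eq_eseriesr (fun n _ => IE n)).
apply: lime_le.
  by apply: is_cvg_nneseries => n _ _; rewrite -IE integral_ge0.
apply: nearW => n; rewrite sumEFin lee_fin.
apply: geometric_le_lim.
- exact: Br0.
- by rewrite divr_gt0.
- by rewrite ger0_norm// divr_ge0 ?(ltW r0)//.
Qed.
End SingularWeight.

(** * Minors and Gram determinants *)

Section Minors.

(* The Cauchy-Binet formula for [A *m A^T], summed over all maps rather than
   over subsets; every k-subset is then counted [k`!] times. *)
Lemma det_mulmx_tr (R : comNzRingType) (k d : nat) (A : 'M[R]_(k, d)) :
  k`!%:R * \det (A *m A^T) =
  \sum_(f : {ffun 'I_k -> 'I_d}) (\det (colsub f A)) ^+ 2.
Proof.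
pose F (f : {ffun 'I_k -> 'I_d}) :=
  (\prod_i A i (f i)) * \det (colsub f A).
have detE : \det (A *m A^T) = \sum_f F f.
  rewrite /determinant; under eq_bigr => s _.
    under eq_bigr => i _ do rewrite mxE.
    rewrite bigA_distr_bigA mulr_sumr /=; over.
  rewrite exchange_big /=; apply: eq_bigr => f _.
  rewrite /F -det_tr /determinant mulr_sumr; apply: eq_bigr => s _.
  rewrite big_split/= mulrCA; congr (_ * (_ * _)).
  by apply: eq_bigr => i _; rewrite !mxE.
(* Precomposing [f] with [s] permutes the columns of the minor and costs the sign of [s]. Summing
   over all [s] completes the product to a second determinant and produces the factor [k!]. *)
have F_perm (s : 'S_k) : \det (A *m A^T) =
    \sum_(f : {ffun 'I_k -> 'I_d})
      (-1) ^+ s * (\prod_i A i (f (s i))) * \det (colsub f A).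
  rewrite detE (reindex (fun f : {ffun 'I_k -> 'I_d} => [ffun i => f (s i)])).
    apply: eq_bigr => f _; rewrite /F.
    have -> : colsub [ffun i => f (s i)] A = col_perm s (colsub f A).
      by apply/matrixP => i j; rewrite !mxE ffunE.
    rewrite (eq_bigr (fun i => A i (f (s i)))) => [|i _]; last by rewrite ffunE.
    rewrite col_permE det_mulmx det_perm odd_permV (mulrC (\det _)) mulrA.
    by congr (_ * _); rewrite mulrC.
  exists (fun f : {ffun 'I_k -> 'I_d} => [ffun i => f (s^-1 i)%g]) => f _;
    by apply/ffunP => i; rewrite !ffunE ?permK ?permKV.
transitivity (\sum_(s : 'S_k) \det (A *m A^T)).
  by rewrite sumr_const card_Sn mulr_natl.
rewrite (eq_bigr _ (fun s _ => F_perm s)) exchange_big/=.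
apply: eq_bigr => f _; rewrite -mulr_suml expr2; congr (_ * _).
rewrite /determinant; apply: eq_bigr => s _; congr (_ * _).
by apply: eq_bigr => i _; rewrite mxE.
Qed.

Variables (R : realType) (d : nat).
Implicit Types (a : 'rV[R]_d) (s : seq 'rV[R]_d).

Definition minor k s (f : {ffun 'I_k -> 'I_d}) : R :=
  \det (\matrix_(i < k, j < k) (nth 0 s i) 0 (f j)).

Definition maxminor k s : R :=
  \big[Num.max/0]_(f : {ffun 'I_k -> 'I_d}) `|minor s f|.

Lemma minor_le_max k s (f : {ffun 'I_k -> 'I_d}) : `|minor s f| <= maxminor k s.
Proof. exact: (le_bigmax _ (fun f => `|minor s f|)). Qed.

Lemma maxminor_ge0 k s : 0 <= maxminor k s.
Proof. by rewrite /maxminor; elim/big_ind : _ => // x y; rewrite le_max => ->. Qed.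

(** The maximum starts from 0, a value that no minor attains when there are no maps
    ([d = 0 < k]). *)
Lemma maxminor_arg k s : maxminor k s != 0 ->
  exists f : {ffun 'I_k -> 'I_d}, maxminor k s = `|minor s f|.
Proof.
rewrite /maxminor; apply: (big_ind (fun x => x != 0 -> exists f, x = `|minor s f|)).
- by rewrite eqxx.
- by move=> x y xP yP; case: (leP x y).
- by move=> f _ _; exists f.
Qed.

Lemma maxminor0 s : maxminor 0 s = 1.
Proof.
apply/eqP; rewrite eq_le; apply/andP; split; last first.
  have f : {ffun 'I_0 -> 'I_d} by apply: finfun => -[].
  by apply: le_trans (minor_le_max s f); rewrite /minor det_mx00 normr1.
rewrite /maxminor; elim/big_ind : _ => [|x y x1 y1|f _].
- exact: ler01.
- by rewrite ge_max x1.
- by rewrite /minor det_mx00 normr1.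
Qed.

Lemma minor_inj k s (f : {ffun 'I_k -> 'I_d}) : minor s f != 0 -> injective f.
Proof.
move=> f0 i j fij; apply/eqP; apply: contraNT f0 => ij.
rewrite /minor -det_tr (determinant_alternate ij)// => l.
by rewrite !mxE fij.
Qed.

Definition ffun_cons k (i : 'I_d) (f : {ffun 'I_k -> 'I_d}) :
    {ffun 'I_k.+1 -> 'I_d} :=
  [ffun j => if unlift ord0 j is Some j' then f j' else i].

(** Laplace expansion along the new row. Its cofactors ignore that row, so they can be read off with
    [a = 0]: the entry in column [i] has coefficient [minor s f], and otherwise only entries in the
    columns of [f] occur. *)
Lemma minor_cons k s (f : {ffun 'I_k -> 'I_d}) i :
  exists c : 'I_k -> R, forall a,
    minor (a :: s) (ffun_cons i f) = a 0 i * minor s f + \sum_j a 0 (f j) * c j.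
Proof.
pose A a := \matrix_(i0 < k.+1, j < k.+1) (nth 0 (a :: s) i0) 0 (ffun_cons i f j).
exists (fun j => cofactor (A 0) ord0 (lift ord0 j)) => a.
rewrite /minor -/(A a) (expand_det_row _ ord0) big_ord_recl.
have fc0 : ffun_cons i f ord0 = i by rewrite ffunE unlift_none.
have fcS j : ffun_cons i f (lift ord0 j) = f j by rewrite ffunE liftK.
congr (_ + _).
  rewrite mxE fc0 /=; congr (_ * _); rewrite /cofactor addn0 expr0 mul1r.
  by congr determinant; apply/matrixP => p q; rewrite !mxE fcS.
apply: eq_bigr => j _; rewrite mxE fcS /=; congr (_ * _).
rewrite /cofactor; congr (_ * \det _).
by apply/matrixP => p q; rewrite !mxE.
Qed.

Lemma sqr_minor_le s (f : {ffun 'I_(size s) -> 'I_d}) :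
  (minor s f) ^+ 2 <= (size s)`!%:R *
    \det (\matrix_(i < size s, j < size s) dotv (nth 0 s i) (nth 0 s j)).
Proof.
pose A := \matrix_(i < size s, j < d) (nth 0 s i) 0 j.
have -> : \matrix_(i < size s, j < size s) dotv (nth 0 s i) (nth 0 s j) =
    A *m A^T.
  by apply/matrixP => i j; rewrite !mxE; apply: eq_bigr => l _; rewrite !mxE.
have -> : minor s f = \det (colsub f A).
  by congr determinant; apply/matrixP => i j; rewrite !mxE.
rewrite det_mulmx_tr (bigD1 f)//= lerDl sumr_ge0// => g _.
exact: sqr_ge0.
Qed.

Lemma maxminor_le_Detv s :
  maxminor (size s) s <= Num.sqrt (size s)`!%:R * Detv s.
Proof.
have [-> |] := eqVneq (maxminor (size s) s) 0.
  by rewrite mulr_ge0// sqrtr_ge0.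
move=> /maxminor_arg[f ->]; rewrite /Detv -sqrtrM ?ler0n//.
by rewrite -sqrtr_sqr ler_wsqrtr// sqr_minor_le.
Qed.
End Minors.

(** * Negative moments of the Gram determinant *)

Section RowStep.
Variable R : realType.

(** Write [D^-p] as a product of [size l] equal powers and bound each by a different [w i]. This
    shares the singularity among the columns, so that each carries a small exponent. *)
Lemma singpow_le_prod (I : eqType) (l : seq I) (p : nat) (w : I -> R) (M D : R) :
  (0 < size l)%N -> 0 < M -> 
  (forall i, i \in l -> M * `|w i| <= D) ->
  (singpow p%:R D <= (M `^ (- p%:R))%:E *
    \prod_(i <- l) singpow (p%:R / (size l)%:R) (w i))%E.
Proof.
move=> l0 M0 MD; set th := p%:R / (size l)%:R.
have [/allP wn0|/allPn[i il]] := boolP (all (fun i => w i != 0) l); last first.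
  rewrite negbK => /eqP wi0; apply: le_trans (leey _) _.
  rewrite (big_rem i)//= [in X in (_ * (X * _))%E]/singpow wi0 eqxx gt0_mulye.
    by rewrite gt0_muley// lte_fin powR_gt0.
  elim/big_ind : _ => [|x y x0 y0|j _]; rewrite ?lte_fin//.
  - exact: mule_gt0.
  - exact: singpow_gt0.
have l0R : (size l)%:R != 0 :> R by rewrite pnatr_eq0 -lt0n.
have th0 : 0 <= th by rewrite divr_ge0.
have D0 : 0 < D.
  case: l l0 wn0 MD {th th0 l0R} => // i l _ wn0 MD.
  apply: lt_le_trans (MD i (mem_head _ _)).
  by rewrite mulr_gt0// normr_gt0 wn0// mem_head.
rewrite /singpow gt_eqF// (gtr0_norm D0).
rewrite (eq_big_seq (fun i => (`|w i| `^ (- th))%:E)) => [|i il]; last first.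
  by rewrite (negbTE (wn0 i il)).
rewrite prodEFin -EFinM lee_fin.
have powE x : 0 < x -> x `^ (- p%:R) = (x `^ (- th)) ^+ size l.
  move=> x0; rewrite -powR_mulrn ?powR_ge0// -powRrM; congr (_ `^ _).
  by rewrite /th mulNr divfK.
rewrite !powE//; elim: (l) wn0 MD => [|i l' IH] wn0 MD.
  by rewrite big_nil !expr0 mulr1.
rewrite big_cons /= !exprS mulrACA; apply: ler_pM.
- exact: powR_ge0.
- by rewrite exprn_ge0// powR_ge0.
- have wi0 : 0 < `|w i| by rewrite normr_gt0 wn0 ?mem_head.
  rewrite -powRM ?(ltW M0)// !powRN lef_pV2 ?posrE ?powR_gt0 ?mulr_gt0//.
  by rewrite ge0_ler_powR ?nnegrE ?mulr_ge0 ?(ltW M0) ?(ltW D0)// MD ?mem_head.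
- by apply: IH => j jl; [apply: wn0|apply: MD]; rewrite inE jl orbT.
Qed.

Lemma coord_measurable_prod (K : eqType) (l : seq K) (q : K -> R -> \bar R) :
  (forall k, measurable_fun [set: R] (q k)) ->
  coord_measurable (fun y : K -> R => \prod_(k <- l) q k (y k))%E.
Proof.
move=> mq d X phi mphi; elim: l => [|k l IH].
  by under eq_fun do rewrite big_nil; exact: measurable_cst.
under eq_fun do rewrite big_cons; apply: emeasurable_funM => //.
exact: (measurableT_comp (mq k)).
Qed.

Lemma gauss_int_prod_le (K : eqType) (l : seq K) (q : K -> R -> \bar R)
    (C : R) x : 0 <= C -> uniq l ->
  (forall k, measurable_fun [set: R] (q k)) ->
  (forall k t, 0 <= q k t)%E ->
  (forall k, \int[@lebesgue_measure R]_t ((gauss1 t)%:E * q k t) <= C%:E)%E ->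
  (gauss_int l (fun y => \prod_(k <- l) q k (y k)) x <= (C ^+ size l)%:E)%E.
Proof.
move=> C0 + mq q0 qC; elim: l x => [|k l IH] x.
  by rewrite /= big_nil expr0.
move=> /= /andP[kl ul].
have P0 y : (0 <= \prod_(j <- l) q j (y j))%E by exact: prode_ge0.
have Pm : coord_measurable (fun y : K -> R => \prod_(j <- l) q j (y j))%E.
  exact: coord_measurable_prod.
rewrite -/(gauss_int (k :: l) _ x) gauss_int_cons.
apply: (@le_trans _ _ (\int[@lebesgue_measure R]_t
    ((C ^+ size l)%:E * ((gauss1 t)%:E * q k t)))%E); last first.
  rewrite ge0_integralZl_EFin ?exprn_ge0//.
  - rewrite exprSr EFinM; apply: lee_wpmul2l => //.
    by rewrite lee_fin exprn_ge0.
  - by move=> t _; rewrite mule_ge0// lee_fin gauss1_ge0.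
  - exact: measurable_gauss1M.
apply: le_integral_nneg => t.
  rewrite mule_ge0 ?lee_fin ?gauss1_ge0// gauss_int_ge0// => y.
  exact: prode_ge0.
rewrite muleCA; apply: lee_wpmul2l; first by rewrite lee_fin gauss1_ge0.
rewrite muleC; apply: (@le_trans _ _ (q k t * gauss_int l
    (fun y => \prod_(j <- l) q j (y j)) (upd x k t))%E); last first.
  by apply: lee_wpmul2l => //; exact: IH.
rewrite -gauss_intZl//; apply: gauss_int_le => y; first exact: prode_ge0.
by move=> yE; rewrite big_cons (yE k kl) /upd eqxx.
Qed.

Variables (T : finType) (d : nat).
Implicit Types (us : seq T) (y : T * 'I_d -> R).

Definition row_of y u : 'rV[R]_d := \row_i y (u, i).

Definition weight p (t : R) : R := (1 + `|t|) ^+ p.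

Lemma weight_ge1 p t : 1 <= weight p t.
Proof. by rewrite exprn_ege1// lerDl. Qed.

Lemma weight_ge0 p t : 0 <= weight p t.
Proof. exact: le_trans ler01 (weight_ge1 p t). Qed.

Lemma measurable_weight p : measurable_fun [set: R] (weight p).
Proof.
by apply: measurable_funX; apply: measurable_funD => //; exact: normr_measurable.
Qed.

(** Up to a constant, this dominates the power [-p] of the Gram determinant of the normalized rows;
    the weights pay for the norms divided out, and they split into single coordinates. *)
Definition minor_weight p us y : \bar R :=
  ((\prod_(u <- us) \prod_(i <- enum 'I_d) weight p (y (u, i)))%:E *
   singpow p%:R (maxminor (size us) [seq row_of y u | u <- us]))%E.

Lemma minor_weight_ge0 p us y : (0 <= minor_weight p us y)%E.
Proof.
apply: mule_ge0; last exact/ltW/singpow_gt0.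
by rewrite lee_fin prodr_ge0// => u _; rewrite prodr_ge0// => i _; exact: weight_ge0.
Qed.

Lemma measurable_bigmax (d' : measure_display) (X : measurableType d')
    (J : Type) (r : seq J) (F : J -> X -> R) :
  (forall j, measurable_fun [set: X] (F j)) ->
  measurable_fun [set: X] (fun x => \big[Num.max/0]_(j <- r) F j x).
Proof.
move=> mF; elim: r => [|j r IH].
  by under eq_fun do rewrite big_nil; exact: measurable_cst.
by under eq_fun do rewrite big_cons; exact: measurable_maxr.
Qed.

Lemma measurable_maxminor (d' : measure_display) (X : measurableType d')
    k us (phi : X -> T * 'I_d -> R) :
  (forall j, measurable_fun [set: X] (fun z => phi z j)) ->
  measurable_fun [set: X]
    (fun z => maxminor k [seq row_of (phi z) u | u <- us]).
Proof.
move=> mphi; apply: measurable_bigmax => f.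
apply: (measurableT_comp (@normr_measurable R _)).
rewrite /minor /determinant; apply: measurable_sum => s.
apply: measurable_funM => //; apply: measurable_prod => i _.
under eq_fun do rewrite mxE.
have [ilt|ige] := ltnP i (size us); last first.
  rewrite (_ : (fun _ => _) = (fun=> 0)); first exact: measurable_cst.
  by apply/funext => z; rewrite nth_default ?size_map// mxE.
have [u0 _] : {u0 : T | true} by case: (us) ilt => // u0 *; exists u0.
rewrite (_ : (fun _ => _) = (fun z => phi z (nth u0 us i, f (s i)))).
  exact: mphi.
by apply/funext => z; rewrite (nth_map u0)// mxE.
Qed.

Lemma coord_measurable_minor_weight p us : coord_measurable (minor_weight p us).
Proof.
move=> d' X phi mphi; apply: emeasurable_funM.
  apply/measurable_EFinP; apply: measurable_prod => u _.
  apply: measurable_prod => i _.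
  exact: (measurableT_comp (measurable_weight p)).
apply: (measurableT_comp (measurable_singpow _)).
exact: measurable_maxminor.
Qed.

(* Integrating out one row multiplies the bound by a constant: if [f] attains
   the largest minor [M] of the remaining rows, then for each of the
   [m = d - k] columns [i] outside [f] the minor on [i :: f] has the form
   [M * (y_i - b_i)] with [b_i] a function of the entries in the columns [f];
   the power [- p] of the maximum is at most [M ^ - p] times the product of the
   [|y_i - b_i| ^ (- p / m)], which are integrable because [p < m]. *)
Lemma gauss_int_row p us u : u \notin us -> (p + (size us).+1 <= d)%N ->
  exists2 C : R, 1 <= C & forall x,
  (gauss_int [seq (u, i) | i <- enum 'I_d] (minor_weight p (u :: us)) x <=
   (C ^+ d)%:E * minor_weight p us x)%E.
Proof.
move=> uus; set k := size us => pkd.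
have kd : (k <= d)%N by lia.
(* The new row is not counted in [k], which is what makes [p < m] strict and [th < 1]. *)
set m := (d - k)%N; have pm : (p < m)%N by rewrite /m; lia.
set th : R := p%:R / m%:R.
have m0 : 0 < m%:R :> R by rewrite ltr0n (leq_trans _ pm).
have [C1 C10 C1P] : exists2 C : R, 0 <= C & forall b,
    (\int[@lebesgue_measure R]_t ((gauss1 t)%:E *
      ((weight p t)%:E * singpow th (t - b))) <= C%:E)%E.
  apply: gauss_singpow_bounded; rewrite divr_ge0 ?ler0n//=.
  by rewrite ltr_pdivrMr// mul1r ltr_nat.
(* Columns inside [f] carry no singularity; exponent 0 bounds the moment of the weight alone. *)
have [C2 C20 C2P] : exists2 C : R, 0 <= C & forall b,
    (\int[@lebesgue_measure R]_t ((gauss1 t)%:E *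
      ((weight p t)%:E * singpow 0 (t - b))) <= C%:E)%E.
  by apply: gauss_singpow_bounded; rewrite lexx ltr01.
pose C := 1 + C1 + C2; have C_1 : 1 <= C by rewrite /C -addrA lerDl addr_ge0.
have C0 : 0 <= C by exact: le_trans C_1.
exists C => // x.
set s := [seq row_of x v | v <- us].
set W := \prod_(v <- us) \prod_(i <- enum 'I_d) weight p (x (v, i)).
have W0 : 0 < W.
  by do 2! (apply: prodr_gt0 => ? _); exact: lt_le_trans (weight_ge1 _ _).
(* If all minors of the remaining rows vanish, the right side is [+oo]. *)
have [M0|Mn0] := eqVneq (maxminor k s) 0.
  rewrite /minor_weight -/W -/s M0 [X in (_ * (_ * X))%E]/singpow eqxx.
  by rewrite gt0_muley ?lte_fin// gt0_muley ?leey// lte_fin exprn_gt0//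
    (lt_le_trans ltr01).
set M := maxminor k s in Mn0.
have M0 : 0 < M by rewrite lt0r Mn0 maxminor_ge0.
have [f Mf] := maxminor_arg Mn0; rewrite -/M in Mf.
have fn0 : minor s f != 0 by rewrite -normr_eq0 -Mf.
have finj := minor_inj fn0.
pose J := [seq i <- enum 'I_d | i \in codom f].
pose Jc := [seq i <- enum 'I_d | i \notin codom f].
have sJ : size J = k.
  by rewrite -[RHS]card_ord -(card_codom finj) cardE /J enumT.
have sJc : size Jc = m.
  have := count_predC (mem (codom f)) (enum 'I_d).
  rewrite -!size_filter -/J -/Jc sJ size_enum_ord => kmd.
  by rewrite /m -[in RHS]kmd addKn.
have c_ i := minor_cons s f i.
pose c i := sval (cid (c_ i)).
have cP i : forall a, minor (a :: s) (ffun_cons i f) =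
    a 0 i * minor s f + \sum_j a 0 (f j) * c i j := svalP (cid (c_ i)).
(* The columns of [f] are placed outside, so the centres [b y i] are constants while the columns in
   [Jc] are integrated. *)
have block_perm : perm_eq [seq (u, i) | i <- enum 'I_d]
    ([seq (u, i) | i <- J] ++ [seq (u, i) | i <- Jc]).
  by rewrite -map_cat perm_map// perm_sym perm_filterC.
have uJ : uniq [seq (u, i) | i <- J].
  by rewrite map_inj_uniq => [|i j []//]; exact/filter_uniq/enum_uniq.
have uJc : uniq [seq (u, i) | i <- Jc].
  by rewrite map_inj_uniq => [|i j []//]; exact/filter_uniq/enum_uniq.
rewrite (gauss_int_perm _ (minor_weight_ge0 p _)
  (coord_measurable_minor_weight p _) block_perm) gauss_int_cat.
pose b y i := - (\sum_j y (u, f j) * c i j) / minor s f.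
pose q1 y (ki : T * 'I_d) t := ((weight p t)%:E * singpow th (t - b y ki.2))%E.
pose q2 (ki : T * 'I_d) t := (weight p t)%:E : \bar R.
have mw : measurable_fun [set: R] (fun t => (weight p t)%:E).
  by apply/measurable_EFinP; exact: measurable_weight.
have q10 y ki t : (0 <= q1 y ki t)%E.
  by apply: mule_ge0; [rewrite lee_fin weight_ge0|exact/ltW/singpow_gt0].
have mq1 y ki : measurable_fun [set: R] (q1 y ki).
  apply: emeasurable_funM => //; apply: (measurableT_comp (measurable_singpow _)).
  exact: measurable_funB.
have q1C y ki : (\int[@lebesgue_measure R]_t ((gauss1 t)%:E * q1 y ki t)
    <= C%:E)%E.
  apply: le_trans (C1P _) _; rewrite lee_fin /C; lra.
have q2C ki : (\int[@lebesgue_measure R]_t ((gauss1 t)%:E * q2 ki t) <= C%:E)%E.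
  apply: (@le_trans _ _ C2%:E); last by rewrite lee_fin /C; lra.
  apply: le_trans (C2P 0); apply: le_integral_nneg => t.
    by rewrite mule_ge0 ?lee_fin ?gauss1_ge0 ?weight_ge0.
  apply: lee_wpmul2l; first by rewrite lee_fin gauss1_ge0.
  rewrite -[leLHS]mule1; apply: lee_wpmul2l; first by rewrite lee_fin weight_ge0.
  by rewrite /singpow; case: ifP => // _; rewrite ?leey// oppr0 powRr0.
pose c0 := W * M `^ (- p%:R).
have c00 : 0 <= c0 by rewrite mulr_ge0 ?powR_ge0 ?(ltW W0).
(* The hypothesis says that [y] differs from [x] at most in row [u]. *)
have inner y : (forall ki, ki \notin [seq (u, i) | i <- J] -> y ki = x ki \/ ki.1 = u) ->
  (gauss_int [seq (u, i) | i <- Jc] (minor_weight p (u :: us)) y <=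
   (c0 * C ^+ m)%:E * \prod_(ki <- [seq (u, i) | i <- J]) q2 ki (y ki))%E.
  move=> yx.
  pose wJ := \prod_(i <- J) weight p (y (u, i)).
  have wJ0 : 0 <= wJ by apply: prodr_ge0 => i _; exact: weight_ge0.
  apply: (@le_trans _ _ (gauss_int [seq (u, i) | i <- Jc] (fun z =>
     (c0 * wJ)%:E * \prod_(ki <- [seq (u, i) | i <- Jc]) q1 y ki (z ki))%E y)).
    apply: gauss_int_le => z; first exact: minor_weight_ge0.
    move=> zy.
    have zx v i : v \in us -> z (v, i) = x (v, i).
      move=> vus; have vu : v != u by apply: contraNneq uus => <-.
      have vn l : (v, i) \notin [seq (u, i) | i <- l].
        by apply/mapP => -[j _ [vE _]]; rewrite vE eqxx in vu.
      by rewrite zy//; case: (yx _ (vn J)) => //= vE; rewrite vE eqxx in vu.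
    have zJ i : i \in codom f -> z (u, i) = y (u, i).
      move=> iJ; rewrite zy//; apply/mapP => -[j].
      by rewrite mem_filter => /andP[+ _] [ij]; rewrite -ij iJ.
    rewrite /minor_weight big_cons.
    have -> : \prod_(v <- us) \prod_(i <- enum 'I_d) weight p (z (v, i)) = W.
      apply: eq_big_seq => v vus; apply: eq_bigr => i _.
      by rewrite zx.
    have -> : \prod_(i <- enum 'I_d) weight p (z (u, i)) =
        wJ * \prod_(i <- Jc) weight p (z (u, i)).
      rewrite (bigID (mem (codom f))) /= -big_filter -[X in _ * X]big_filter.
      congr (_ * _); apply: eq_big_seq => i; rewrite mem_filter => /andP[iJ _].
      by rewrite zJ.
    have -> : [seq row_of z v | v <- u :: us] = row_of z u :: s.
      rewrite /=; congr (_ :: _); apply/eq_in_map => v vus.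
      by apply/rowP => i; rewrite !mxE zx.
    have MD i : i \in Jc -> M * `|z (u, i) - b y i| <= maxminor k.+1 (row_of z u :: s).
      move=> iJc; apply: le_trans (minor_le_max _ (ffun_cons i f)).
      rewrite cP Mf -normrM le_eqVlt; apply/orP; left; apply/eqP; congr `|_|.
      rewrite /b mulNr opprK mulrDr mulrC [_ * (_ / _)]mulrCA mulfV// mulr1.
      rewrite !mxE; congr (_ + _); apply: eq_bigr => j _.
      by rewrite !mxE zJ// codom_f.
    have l0 : (0 < size Jc)%N by rewrite sJc (leq_trans _ pm).
    have := singpow_le_prod p l0 M0 MD; rewrite sJc -/th => sP.
    rewrite big_map big_split/= prodEFin muleA -EFinM.
    apply: (@le_trans _ _ ((wJ * (\prod_(i <- Jc) weight p (z (u, i))) * W)%:E *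
      ((M `^ (- p%:R))%:E * \prod_(i <- Jc) singpow th (z (u, i) - b y i)))%E).
      apply: lee_wpmul2l => //; rewrite lee_fin !mulr_ge0 ?(ltW W0)//.
      by apply: prodr_ge0 => i _; exact: weight_ge0.
    rewrite muleA -EFinM /c0 le_eqVlt; apply/orP; left; apply/eqP.
    congr (_%:E * _)%E; ring.
  have P0 z : (0 <= \prod_(ki <- [seq (u, i) | i <- Jc]) q1 y ki (z ki))%E.
    by apply: prode_ge0 => ki _.
  rewrite gauss_intZl//; last 2 first.
  - by apply: coord_measurable_prod => ki.
  - by rewrite lee_fin mulr_ge0.
  rewrite big_map prodEFin -/wJ -EFinM [c0 * _ * _]mulrAC [leRHS]EFinM.
  apply: lee_wpmul2l; first by rewrite lee_fin mulr_ge0.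
  apply: le_trans (gauss_int_prod_le _ C0 uJc (mq1 y) (q10 y) (q1C y)) _.
  by rewrite size_map sJc.
apply: (@le_trans _ _ (gauss_int [seq (u, i) | i <- J] (fun y => (c0 * C ^+ m)%:E *
   \prod_(ki <- [seq (u, i) | i <- J]) q2 ki (y ki))%E x)).
  apply: gauss_int_le => y; first exact/gauss_int_ge0/minor_weight_ge0.
  by move=> yx; apply: inner => ki kiJ; left; exact: yx.
rewrite gauss_intZl//; last 3 first.
- by move=> y; apply: prode_ge0 => ki _; rewrite lee_fin weight_ge0.
- by apply: coord_measurable_prod.
- by rewrite lee_fin mulr_ge0// exprn_ge0.
have q20 ki t : (0 <= q2 ki t)%E by rewrite lee_fin weight_ge0.
apply: (@le_trans _ _ ((c0 * C ^+ m)%:E * (C ^+ k)%:E)%E).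
  apply: lee_wpmul2l; first by rewrite lee_fin mulr_ge0// exprn_ge0.
  apply: le_trans (gauss_int_prod_le _ C0 uJ (fun=> mw) q20 q2C) _.
  by rewrite size_map sJ.
rewrite /minor_weight -/W -/s -/k -/M /singpow (negbTE Mn0) (gtr0_norm M0).
by rewrite -!EFinM lee_fin -(mulrA c0) -exprD subnK// [leRHS]mulrC.
Qed.

End RowStep.

(** * All rows of a vertex, and the passage from Gaussian to unit vectors *)

Section VertexBound.
Variables (R : realType) (T : finType) (d : nat).
Implicit Types (us : seq T) (y z : T * 'I_d -> R) (s : seq 'rV[R]_d).

Lemma minor_weight_eq p us y z :
  (forall u i, u \in us -> y (u, i) = z (u, i)) ->
  minor_weight p us y = minor_weight p us z.
Proof.
move=> yz; rewrite /minor_weight.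
have -> : [seq row_of y u | u <- us] = [seq row_of z u | u <- us].
  by apply/eq_in_map => u uus; apply/rowP => i; rewrite !mxE yz.
congr (_%:E * _)%E; apply: eq_big_seq => u uus.
by apply: eq_bigr => i _; rewrite yz.
Qed.

(** Induction on the rows: the coordinates of [u] are moved innermost, where [gauss_int_row] trades
    them for a constant. The exponent [p] stays fixed while rows disappear, so the condition only
    becomes weaker. The list [l] may contain further coordinates, as it will when all of [U] is
    integrated. *)
Lemma gauss_int_minor_weight p us : uniq us -> (p + size us <= d)%N ->
  exists C : R, forall (l : seq (T * 'I_d)) x, uniq l ->
    (forall u i, u \in us -> (u, i) \in l) ->
    (gauss_int l (minor_weight p us) x <= C%:E)%E.
Proof.
elim: us => [|u us IH] /=.
  move=> _ _; exists 1 => l x _ _.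
  rewrite (_ : minor_weight p [::] = fun=> 1%E) ?gauss_int_cst ?lee_fin//.
  apply/funext => y; rewrite /minor_weight big_nil mul1e maxminor0.
  by rewrite /singpow oner_eq0 normr1 powR1.
move=> /andP[uus us_uniq] pd.
have [|C CP] := IH us_uniq; first by rewrite (leq_trans _ pd)// leq_add2l.
have [C' C'1 C'P] := gauss_int_row R uus pd.
have C'0 : 0 <= C' ^+ d by rewrite exprn_ge0// (le_trans ler01).
exists (C' ^+ d * C) => l x l_uniq ul.
pose l' := [seq k <- l | k.1 != u].
have l_perm : perm_eq l (l' ++ [seq (u, i) | i <- enum 'I_d]).
  apply: uniq_perm => //.
    rewrite cat_uniq filter_uniq//= map_inj_uniq => [|i j []//].
    rewrite enum_uniq andbT; apply/hasPn => _ /mapP[i _ ->].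
    by rewrite mem_filter eqxx.
  move=> [v i]; rewrite mem_cat mem_filter /=.
  have [->|vu] := eqVneq v u.
    by rewrite ul ?mem_head// map_f// mem_enum.
  rewrite /=; case: ((v, i) \in l) => //=; apply/esym/negbTE/mapP => -[j _ [vE _]].
  by rewrite vE eqxx in vu.
have mw0 q vs y : (0 <= minor_weight q vs y)%E by exact: minor_weight_ge0.
have mmw q vs : coord_measurable (@minor_weight R T d q vs).
  exact: coord_measurable_minor_weight.
rewrite (gauss_int_perm _ (mw0 _ _) (mmw _ _) l_perm) gauss_int_cat.
apply: (@le_trans _ _ (gauss_int l' (fun y =>
    (C' ^+ d)%:E * minor_weight p us y)%E x)).
  by apply: gauss_int_le => [y|y _]; [exact: gauss_int_ge0|exact: C'P].
rewrite gauss_intZl// EFinM; apply: lee_wpmul2l; rewrite ?lee_fin//.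
apply: CP => [|v i vus]; first exact: filter_uniq.
rewrite mem_filter ul ?inE ?vus ?orbT// andbT /=.
by apply: contraNneq uus => <-.
Qed.

(** The zero vector is included: there the norm is 0, [normalize] returns 0, and norm 0 forces every
    coordinate to vanish. *)
Lemma enorm_normalize (a : 'rV[R]_d) j : a 0 j = enorm a * normalize a 0 j.
Proof.
rewrite mxE mulrA; have [a0|an0] := eqVneq (enorm a) 0; last first.
  by rewrite mulfV// mul1r.
rewrite a0 !mul0r; apply/eqP; rewrite -sqrf_eq0.
move/eqP: a0; rewrite sqrtr_eq0 /dotv => s0.
rewrite eq_le sqr_ge0 andbT (le_trans _ s0)//.
rewrite (bigD1 j)//= expr2 lerDl sumr_ge0// => i _.
by rewrite -expr2 sqr_ge0.
Qed.

Lemma minor_normalize s (f : {ffun 'I_(size s) -> 'I_d}) :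
  minor s f = (\prod_(a <- s) enorm a) * minor [seq normalize a | a <- s] f.
Proof.
pose D := \row_(i < size s) enorm (nth 0 s i).
transitivity (\det (diag_mx D *m
    \matrix_(i < size s, j < size s) [seq normalize a | a <- s]`_i 0 (f j))).
  congr determinant; apply/matrixP => i j; rewrite mul_diag_mx !mxE.
  by rewrite (nth_map 0)// -enorm_normalize.
rewrite det_mulmx det_diag (big_nth 0) big_mkord; congr (_ * _).
by apply: eq_bigr => i _; rewrite mxE.
Qed.

Lemma enorm_ge0 (a : 'rV[R]_d) : 0 <= enorm a.
Proof. exact: sqrtr_ge0. Qed.

(** A product bound is chosen because the weight must factor over coordinates. The induction carries
    [1 +] the sum of squares, bounded by the squared product. *)
Lemma enorm_row_le y u :
  enorm (row_of y u) <= \prod_(i <- enum 'I_d) (1 + `|y (u, i)|).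
Proof.
have prod_sqr (r : seq 'I_d) : 1 <= \prod_(i <- r) (1 + `|y (u, i)|) /\
    1 + \sum_(i <- r) y (u, i) ^+ 2 <= (\prod_(i <- r) (1 + `|y (u, i)|)) ^+ 2.
  elim: r => [|i r [IH1 IH2]]; first by rewrite !big_nil expr1n addr0.
  rewrite !big_cons -(real_normK (num_real (y (u, i)))).
  have t0 : 0 <= `|y (u, i)| by [].
  move: IH1 IH2; move: (\prod_(_ <- r) _) (\sum_(_ <- r) _) => P S P1 SP.
  move: t0; move: `|_| => t t0.
  have P2 : 1 <= P ^+ 2 by rewrite exprn_ege1.
  have : 0 <= t * P ^+ 2 by rewrite mulr_ge0// (le_trans ler01).
  have : 0 <= t ^+ 2 * (P ^+ 2 - 1) by rewrite mulr_ge0 ?sqr_ge0// subr_ge0.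
  by split; nra.
have [P1 SP] := prod_sqr (enum 'I_d).
rewrite -[leRHS]ger0_norm ?(le_trans ler01)// -sqrtr_sqr ler_wsqrtr//.
apply: le_trans SP; rewrite -[leLHS]add0r lerD// le_eqVlt; apply/orP; left.
by rewrite big_enum; apply/eqP; apply: eq_bigr => i _; rewrite mxE expr2.
Qed.

(** Pulling the norms out of the rows and applying [maxminor_le_Detv] to the normalized ones gives
    [D <= q V E], with [D] the largest minor, [V] the bound on the norms and [E] the normalized
    determinant. Raising to the power [-p] reverses it; [D = 0] makes the right side infinite. *)
Lemma singpow_Detv_le p y us :
  (singpow p%:R (Detv [seq normalize (row_of y u) | u <- us]) <=
   (Num.sqrt (size us)`!%:R ^+ p)%:E * minor_weight p us y)%E.
Proof.
set s := [seq row_of y u | u <- us].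
have -> : [seq normalize (row_of y u) | u <- us] = [seq normalize a | a <- s].
  by rewrite /s -map_comp.
have sE : size s = size us by rewrite size_map.
set q := Num.sqrt _; have q0 : 0 < q by rewrite sqrtr_gt0 ltr0n fact_gt0.
pose V := \prod_(u <- us) \prod_(i <- enum 'I_d) (1 + `|y (u, i)|).
have V0 : 0 < V.
  by do 2! (apply: prodr_gt0 => ? _); rewrite ltr_pwDl.
have WE : \prod_(u <- us) \prod_(i <- enum 'I_d) weight p (y (u, i)) = V ^+ p.
  by rewrite -prodrXl; apply: eq_bigr => u _; rewrite -prodrXl.
rewrite /minor_weight WE -/s muleA -EFinM -exprMn.
have [D0|Dn0] := eqVneq (maxminor (size us) s) 0.
  rewrite D0 [X in (_ <= _ * X)%E]/singpow eqxx.
  by rewrite gt0_muley ?leey// lte_fin exprn_gt0// mulr_gt0.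
set D := maxminor (size us) s.
have D0 : 0 < D by rewrite lt0r Dn0 maxminor_ge0.
have DV : D <= q * V * Detv [seq normalize a | a <- s].
  have [f Df] : exists f : {ffun 'I_(size s) -> 'I_d}, D = `|minor s f|.
    by rewrite sE; exact: maxminor_arg.
  rewrite Df minor_normalize normrM [leRHS]mulrAC [leRHS]mulrC.
  apply: ler_pM => //.
    rewrite ger0_norm; last by apply: prodr_ge0 => a _; exact: enorm_ge0.
    rewrite /s big_map; apply: ler_prod => u _.
    by rewrite enorm_ge0 enorm_row_le.
  apply: le_trans (minor_le_max _ _) _; rewrite -(size_map (@normalize R d) s).
  apply: le_trans (maxminor_le_Detv _) _.
  by rewrite !size_map -/q.
set E := Detv _ in DV *.
have qV0 : 0 < q * V by rewrite mulr_gt0.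
have E0 : 0 < E by rewrite -(pmulr_rgt0 _ qV0) (lt_le_trans D0).
rewrite /singpow !gt_eqF// (gtr0_norm D0) (gtr0_norm E0) -EFinM lee_fin.
rewrite !powRN -!powR_mulrn ?(ltW qV0)//.
rewrite ler_pdivlMr ?powR_gt0// mulrC ler_pdivrMr ?powR_gt0//.
rewrite -powRM ?(ltW qV0) ?(ltW E0)//.
apply: ge0_ler_powR => //; rewrite nnegrE; first exact: ltW.
by apply: mulr_ge0; exact: ltW.
Qed.

(** Puts the reciprocal in the form of a root of a [p]-th power, as Finner's inequality requires. *)
Lemma singpow1 p (x : R) : (0 < p)%N ->
  (singpow 1 x = singpow p%:R x `^ p%:R^-1)%E.
Proof.
move=> p0; have pn0 : p%:R != 0 :> R by rewrite pnatr_eq0 -lt0n.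
rewrite /singpow; case: eqP => _; first by rewrite poweRyr// invr_eq0.
by rewrite poweR_EFin -powRrM mulNr mulfV.
Qed.

Lemma sphere_area_gt0 k : 0 < sphere_area R k.
Proof.
have pi2 : 0 < pi *+ 2 :> R by rewrite pmulrn_lgt0// pi_gt0.
suff [] : 0 < sphere_area R k /\ 0 < sphere_area R k.+1 by [].
elim: k => [|k [IH1 IH2]]; first by split; rewrite //= ltr0n.
by split => //=; rewrite mulr_gt0// divr_gt0// ltr0n.
Qed.
End VertexBound.

(** * Finiteness of the density *)

Lemma lee_prod_nneg (R : realType) (I : Type) (r : seq I) (P : pred I)
    (F G : I -> \bar R) :
  (forall i, P i -> 0 <= F i)%E -> (forall i, P i -> F i <= G i)%E ->
  (\prod_(i <- r | P i) F i <= \prod_(i <- r | P i) G i)%E.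
Proof.
move=> F0 FG.
suff /andP[] : (0 <= \prod_(i <- r | P i) F i <=
  \prod_(i <- r | P i) G i)%E by [].
elim/big_ind2 : _ => [|a b x z /andP[a0 ab] /andP[x0 xz]|i Pi].
- by rewrite lexx lee_fin ler01.
- by rewrite mule_ge0// lee_pmul.
- by rewrite F0 ?FG.
Qed.

Theorem theorem14 (R : realType) (T : finType) (e : rel T) (U W : {set T})
    (d : nat) :
  (3 <= d)%N ->
  bipartite_graph e U W ->
  (forall u, u \in U ->
     (forall v, v \in nbhd e u -> (deg e v < d)%N) /\
     \sum_(v in nbhd e u) ((d - deg e v)%:R : R)^-1 <= 1) ->
  (ortho_density R e U W d < +oo)%E.
Proof.
move=> d3 [e_sym _ _ _ eUW] hU.
have nbhdU v u : v \in W -> u \in nbhd e v -> u \in U.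
  by rewrite inE e_sym => vW /eUW ->.
(* For an isolated vertex the bound comes from [3 <= d]; otherwise a neighbour in [U] supplies
   it. *)
have degW v : v \in W -> (deg e v < d)%N.
  move=> vW; have [/card0_eq n0|] := posnP (deg e v).
    by rewrite /deg eq_card0// (leq_trans _ d3).
  move=> /card_gt0P[u uv]; have [+ _] := hU u (nbhdU v u vW uv).
  by apply; rewrite inE e_sym; rewrite inE in uv.
pose us v := enum (nbhd e v).
have us_size v : size (us v) = deg e v by rewrite -cardE.
pose p v := (d - deg e v)%N.
have p0 v : v \in W -> (0 < p v)%N by move=> vW; rewrite subn_gt0 degW.
pose a v : R := (p v)%:R^-1.
pose B v : R := Num.sqrt (size (us v))`!%:R ^+ p v.
have B0 v : 0 <= B v by rewrite exprn_ge0// sqrtr_ge0.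
have B0' v : (0 <= (B v)%:E)%E by rewrite lee_fin.
(* Adding 1 meets the lower bound demanded by [gauss_Finner] and raises the integral by exactly
   1. *)
pose g v (y : T * 'I_d -> R) := (1 + (B v)%:E * minor_weight (p v) (us v) y)%E.
have mw0 v y : (0 <= minor_weight (R := R) (d := d) (p v) (us v) y)%E.
  exact: minor_weight_ge0.
have mmw v : coord_measurable (@minor_weight R T d (p v) (us v)).
  exact: coord_measurable_minor_weight.
have Bmw0 v y : (0 <= (B v)%:E * minor_weight (R := R) (d := d) (p v) (us v) y)%E.
  exact: mule_ge0.
have mBmw v : coord_measurable
    (fun y => (B v)%:E * @minor_weight R T d (p v) (us v) y)%E.
  by move=> d' X phi mphi; apply: measurable_funeM; exact: mmw.
have g1 v y : (1 <= g v y)%E by rewrite /g leeDl.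
have mg v : coord_measurable (g v).
  by move=> d' X phi mphi; apply: emeasurable_funD => //; exact: mBmw.
pose L := [seq (u, i) | u <- enum U, i <- enum 'I_d].
have L_uniq : uniq L.
  by apply: allpairs_uniq; rewrite ?enum_uniq// => -[? ?] [? ?] _ _ [-> ->].
have g_fin v : v \in W -> gauss_int L (g v) (fun=> 0) \is a fin_num.
  move=> vW; rewrite /g gauss_intD// gauss_int_cst// gauss_intZl//.
  have us_le : (p v + size (us v) <= d)%N by rewrite us_size subnK// ltnW// degW.
  have [C CP] := gauss_int_minor_weight R (enum_uniq _) us_le.
  rewrite fin_numD fin_numM// ge0_fin_numE ?gauss_int_ge0//.
  apply: le_lt_trans (ltry C); apply: CP => // u i.
  by rewrite mem_enum => uv; rewrite allpairs_f// mem_enum// (nbhdU v).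
pose A : R := \prod_(v in W) sphere_area R (d - deg e v - 1).
have A0 : 0 <= A by apply: prodr_ge0 => v _; rewrite ltW// sphere_area_gt0.
pose x_ (y : T * 'I_d -> R) u := normalize (row_of y u).
have invDet_le v y : v \in W ->
    (singpow 1 (Detv [seq x_ y w | w <- us v]) <= g v y `^ a v)%E.
  move=> vW; rewrite (singpow1 _ (p0 v vW)).
  have sp0 x : (0 <= singpow (R := R) (p v)%:R x)%E by exact/ltW/singpow_gt0.
  apply: gt0_ler_poweR.
  - by rewrite invr_ge0 ler0n.
  - by rewrite in_itv/= sp0 leey.
  - by rewrite in_itv/= leey andbT (le_trans _ (g1 v y))// lee_fin.
  - apply: le_trans (singpow_Detv_le _ _ _) _.
    by rewrite /g leeDr// lee_fin.
have integrand_ge0 y : (0 <= ortho_integrand (R := R) e W (x_ y))%E.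
  rewrite /ortho_integrand; case: ifP => // _; rewrite lee_fin prodr_ge0// => v _.
  by rewrite divr_ge0// ?sqrtr_ge0// ltW// sphere_area_gt0.
have integrand_le y : (ortho_integrand (R := R) e W (x_ y) <=
    A%:E * \prod_(v in W) g v y `^ a v)%E.
  apply: (@le_trans _ _ (\prod_(v in W) ((sphere_area R (d - deg e v - 1))%:E *
      singpow 1 (Detv [seq x_ y w | w <- us v])))%E); last first.
    rewrite /A -prodEFin -big_split/=; apply: lee_prod_nneg => v vW.
      by rewrite mule_ge0 ?(ltW (singpow_gt0 _ _))// lee_fin ltW// sphere_area_gt0.
    by apply: lee_wpmul2l; [rewrite lee_fin ltW// sphere_area_gt0|exact: invDet_le].
  (* A vanishing determinant makes one factor [+oo]; all other factors are positive, so the product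
     is [+oo] as well. *)
  rewrite /ortho_integrand; case: ifPn => [/exists_inP[v vW /eqP D0]|].
    rewrite (bigD1 v)//= [in X in (_ <= _ * X * _)%E]/singpow D0 eqxx.
    rewrite gt0_muley ?lte_fin ?sphere_area_gt0// gt0_mulye//.
    elim/big_ind : _ => [|b c b0 c0|w _]; rewrite ?lte_fin//; apply: mule_gt0 => //.
      by rewrite lte_fin sphere_area_gt0.
    exact: singpow_gt0.
  rewrite negb_exists => /forallP D0.
  rewrite -prodEFin le_eqVlt; apply/orP; left; apply/eqP; apply: eq_bigr => v vW.
  have := D0 v; rewrite vW /= => Dn0.
  by rewrite EFinM /singpow (negbTE Dn0) powR_inv1 ?ger0_norm ?sqrtr_ge0.
pose I := sphere_int U (@ortho_integrand R T e W d).
have I0 : (0 <= I)%E by exact: gauss_int_ge0.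
suff I_fin : I \is a fin_num.
  by rewrite /ortho_density -/I -(fineK I_fin) -EFinM ltry.
rewrite ge0_fin_numE//.
have P0 y : (0 <= \prod_(v in W) g v y `^ a v)%E.
  by apply: prode_ge0 => v _; exact: poweR_ge0.
have mP : coord_measurable (fun y => \prod_(v in W) g v y `^ a v)%E.
  move=> d' X phi mphi; under eq_fun do rewrite -big_filter.
  elim: [seq i <- _ | _] => [|v r IHr].
    by under eq_fun do rewrite big_nil; exact: measurable_cst.
  under eq_fun do rewrite big_cons; apply: emeasurable_funM => //.
  by apply: (measurableT_comp (measurable_poweR _)); exact: mg.
apply: (@le_lt_trans _ _ (gauss_int L
    (fun y => A%:E * \prod_(v in W) g v y `^ a v)%E (fun=> 0))).
  by apply: gauss_int_le => y; [exact: integrand_ge0|move=> _; exact: integrand_le].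
rewrite gauss_intZl//.
apply: (@le_lt_trans _ _ (A%:E *
    \prod_(v in W) (gauss_int L (g v) (fun=> 0%R)) `^ a v)%E); last first.
  rewrite -ge0_fin_numE; last first.
    by rewrite mule_ge0// prode_ge0// => v _; exact: poweR_ge0.
  by rewrite fin_numM// prode_fin_num// => v vW; rewrite fin_num_poweR// g_fin.
apply: lee_wpmul2l; first by rewrite lee_fin.
apply: (gauss_Finner (dep := fun v k => k.1 \in nbhd e v)) => //.
- move=> v [u i] y t vW /= uv; rewrite /g; congr (_ + _ * _)%E.
  apply: minor_weight_eq => w j; rewrite mem_enum /upd => wv.
  by case: eqP => // -[wu _]; rewrite -wu wv in uv.
- by move=> v vW; rewrite invr_gt0 ltr0n p0.
(* The vertices of [W] whose factor depends on a coordinate of [u] are exactly the neighbours of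
   [u], so the weight condition is the assumed inequality at [u]. *)
- move=> [u i] /allpairsP[[u' i'] /= [+ _ [-> _]]]; rewrite mem_enum => uU.
  have [_] := hU u' uU; apply: le_trans; rewrite le_eqVlt; apply/orP; left.
  apply/eqP; apply: eq_bigl => v; rewrite !inE (e_sym v).
  by case: (boolP (e u' v)) => [/eUW <-|]; rewrite ?uU ?andbF.
Qed.
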